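(* Let $\mathcal{H}_1$, $K$ and $L$ be as in the context, let $t_1,\ldots,t_d\in[0,1]$ be such that the matrix $\mathbf{K}_d=(K(t_i,t_j))_{i,j=1,\ldots,d}$ is positive definite, let $\gamma>0$ and $C>0$, and let $x_1,\ldots,x_n\in\mathcal{H}_1$ and $y_1,\ldots,y_n\in\{-1,1\}$. Put $\mathbf{x}_i=(x_i(t_1),\ldots,x_i(t_d))^T\in\mathbb{R}^d$ and let $h_i\in\mathcal{H}_1$ be the $L$-spline interpolating $x_i$ at $t_1,\ldots,t_d$. Let $G_\gamma^d(u,v)=e^{-\gamma\|u-v\|^2_{\mathbb{R}^d}}$ be the Gaussian kernel on $\mathbb{R}^d$ and $G_\gamma^\infty(u,v)=e^{-\gamma\|u-v\|^2_{L^2}}$ the Gaussian kernel on $L^2([0,1])$. Then the SVM $\phi_h^{n,d}$ on the derivatives $Lh_1,\ldots,Lh_n$, defined by $$\max_{\alpha}\ \sum_{i=1}^n\alpha_i-\sum_{i,j=1}^n\alpha_i\alpha_j y_iy_j\,G_\gamma^\infty(Lh_i,Lh_j)\quad\text{subject to}\quad \sum_{i=1}^n\alpha_iy_i=0,\ \ 0\le\alpha_i\le C,\ 1\le i\le n,$$ is equivalent to the SVM $\phi_{\mathbf{x}}^{n,d}$ on the discretizations $\mathbf{x}_1,\ldots,\mathbf{x}_n$, defined by $$\max_{\alpha}\ \sum_{i=1}^n\alpha_i-\sum_{i,j=1}^n\alpha_i\alpha_j y_iy_j\,\big(G_\gamma^d\circ\mathbf{K}_d^{-1/2}\big)(\mathbf{x}_i,\mathbf{x}_j)\quad\text{subject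 to}\quad \sum_{i=1}^n\alpha_iy_i=0,\ \ 0\le\alpha_i\le C,\ 1\le i\le n.$$ That is, the two optimization problems coincide (same feasible set, same objective function), and the resulting classifiers agree: $\phi_h^{n,d}(x)=\phi_{\mathbf{x}}^{n,d}\big((x(t_1),\ldots,x(t_d))^T\big)$ for every $x\in\mathcal{H}_1$.
   Context: Setting. $m\ge 1$ is an integer, $\mathcal{H}^m=\mathcal{H}^m([0,1])$ is the Sobolev space of $h\in L^2([0,1])$ whose weak derivatives $D^jh$, $j=1,\ldots,m$, exist and lie in $L^2([0,1])$. $L=D^m+\sum_{j=0}^{m-1}a_jD^j$ is a differential operator such that $\mathcal{H}_0=\mathrm{Ker}\,L$ is an $m$-dimensional subspace of $\mathcal{H}^m$ and $\mathcal{H}^m=\mathcal{H}_0\oplus\mathcal{H}_1$, where $\mathcal{H}_1$ is the subspace of $\mathcal{H}^m$ defined by $m$ linear boundary conditions $B^jh=0$, $j=1,\ldots,m$. $\mathcal{H}_1$ is equipped with the inner product $\langle u,v\rangle_1=\int_{[0,1]}Lu(t)\,Lv(t)\,dt$, for which it is a reproducing kernel Hilbert space (of functions on $[0,1]$) with reproducing kernel $K$; its norm is $\|\cdot\|_1$. $L$-spline interpolation. When $\mathbf{K}_d=(K(t_i,t_j))_{i,j=1,\ldots,d}$ is positive definite and $x\in\mathcal{H}_1$, the $L$-spline interpolating $x$ at $t_1,\ldots,t_d$ is the unique element $h\in\mathcal{H}_1$ of minimal norm $\|h\|_1$ with $h(t_k)=x(t_k)$ for all $k$. Explicitly, $h=\sum_{i=1}^dc_iK(t_i,\cdot)$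 with $c=\mathbf{K}_d^{-1}(x(t_1),\ldots,x(t_d))^T$. Composed kernel. $(G_\gamma^d\circ\mathbf{K}_d^{-1/2})(\mathbf{u},\mathbf{v})=G_\gamma^d(\mathbf{K}_d^{-1/2}\mathbf{u},\mathbf{K}_d^{-1/2}\mathbf{v})$ for $\mathbf{u},\mathbf{v}\in\mathbb{R}^d$. SVM classifier. Given a kernel $k$, inputs $u_1,\ldots,u_n$, labels $y_1,\ldots,y_n\in\{-1,1\}$ and $C>0$, let $\alpha^*$ be a solution of: maximize $\sum_i\alpha_i-\sum_{i,j}\alpha_i\alpha_jy_iy_jk(u_i,u_j)$ subject to $\sum_i\alpha_iy_i=0$, $0\le\alpha_i\le C$. The SVM classifier is $u\mapsto\mathrm{sign}\big(2\sum_i\alpha_i^*y_ik(u_i,u)+b^*\big)$ (with $\mathrm{sign}(0)=1$), where $b^*$ minimizes $b\mapsto\sum_{l}\max\big(0,\,1-y_l(2\sum_i\alpha_i^*y_ik(u_i,u_l)+b)\big)$. Any non-uniqueness in $(\alpha^*,b^* )$ is resolved by a fixed rule depending only on the Gram matrix $(k(u_i,u_j))_{i,j}$, the labels and $C$. The classifier $\phi_{\mathbf{x}}^{n,d}$ is the one with kernel $G_\gamma^d\circ\mathbf{K}_d^{-1/2}$ and inputs $\mathbf{x}_i$. The classifier $\phi_h^{n,d}$ is the one with kernel $G_\gamma^\infty$ and inputs $Lh_i$, and it is applied to $x\in\mathcal{H}_1$ by evaluating it at $Lh$, where $h$ is the $L$-spline interpolating $x$ at $t_1,\ldots,t_d$.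 *)

(* Defs.v *)
From HB Require Import structures.
From mathcomp Require Import all_boot all_order all_algebra.
From mathcomp Require Import all_classical all_reals all_analysis.

Set Implicit Arguments.
Unset Strict Implicit.
Unset Printing Implicit Defensive.

Import Order.TTheory GRing.Theory Num.Theory.
Import numFieldNormedType.Exports.

Local Open Scope classical_set_scope.
Local Open Scope ring_scope.

(* Functions on [0,1] are represented by functions
   R -> R whose values outside [0,1] are irrelevant: every notion below looks
   at [0,1] only, and equality of two functions is equality on [0,1]. *)

Definition I01 (R : realType) : set R := `[0, 1]%classic.
Arguments I01 {R}.

Definition eq01 (R : realType) (u v : R -> R) : Prop :=
  forall s, I01 s -> u s = v s.

(* f is square integrable on [0,1]: its extension by 0 belongs to L^2(R) *)
Definition L2_01 (R : realType) (f : R -> R) : Prop :=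
  (f \_ I01) \in Lfun (@lebesgue_measure R) 2%:E.

Definition L2norm (R : realType) (f : R -> R) : R :=
  fine (Lnorm (@lebesgue_measure R) 2%:E (EFin \o (f \_ I01))).

(* C^oo functions with compact support in the open interval ]0,1[ *)
Definition test_function (R : realType) (phi : R -> R) : Prop :=
  (forall (k : nat) (s : R), derivable (derive1n k phi) s 1) /\
  (exists p q : R, [/\ 0 < p, q < 1 & forall s, ~~ (p <= s <= q) -> phi s = 0]).

Definition is_weak_derivative (R : realType) (j : nat) (h g : R -> R) : Prop :=
  forall phi : R -> R, test_function phi ->
    (\int[@lebesgue_measure R]_(s in I01) (h s * derive1n j phi s) =
     (-1) ^+ j * \int[@lebesgue_measure R]_(s in I01) (g s * phi s))%R.

(* The Sobolev space H^m([0,1]), m >= 1.  A class of H^m modulo a.e. equality is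
   represented by its unique continuous representative, so that h s makes sense
   for every s in [0,1]. *)
Definition sobolev (R : realType) (m : nat) : set (R -> R) :=
  [set h | [/\ {within I01, continuous h}, L2_01 h &
      forall j, (1 <= j <= m)%N ->
        exists g, L2_01 g /\ is_weak_derivative j h g]].

(* D^j h; it is determined up to a.e. equality on [0,1], and D^0 h = h a.e. *)
Definition weak_D (R : realType) (j : nat) (h : R -> R) : R -> R :=
  xget (fun=> 0) [set g | L2_01 g /\ is_weak_derivative j h g].

Definition diffop (R : realType) (m : nat) (a : 'I_m -> R -> R) (h : R -> R)
    : R -> R :=
  fun s => weak_D m h s + \sum_(j < m) a j s * weak_D j h s.

Definition kerL (R : realType) (m : nat) (a : 'I_m -> R -> R) : set (R -> R) :=
  [set h | sobolev m h /\
    {ae @lebesgue_measure R, forall s, I01 s -> diffop a h s = 0}].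

(* V is an m-dimensional vector space of functions on [0,1] *)
Definition has_dim (R : realType) (V : set (R -> R)) (m : nat) : Prop :=
  exists e : 'I_m -> R -> R,
    (forall c : 'rV[R]_m, V (fun s => \sum_(i < m) c 0 i * e i s)) /\
    (forall h, V h ->
       exists! c : 'rV[R]_m, eq01 h (fun s => \sum_(i < m) c 0 i * e i s)).

(* A linear boundary form on H^m: a linear functional whose value is determined
   by the behaviour of h near the endpoints 0 and 1 (for instance any linear
   combination of the h^(k)(0) and h^(k)(1), k < m). *)
Definition linear_boundary_form (R : realType) (m : nat) (b : (R -> R) -> R)
    : Prop :=
  (forall (c : R) (u v : R -> R), sobolev m u -> sobolev m v ->
     b (fun s => c * u s + v s) = c * b u + b v) /\
  (forall h : R -> R, sobolev m h ->
     (exists2 e : R, 0 < e &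
        forall s, I01 s -> s < e \/ 1 - e < s -> h s = 0) ->
     b h = 0).

Definition H1 (R : realType) (m : nat) (B : 'I_m -> (R -> R) -> R)
    : set (R -> R) :=
  [set h | sobolev m h /\ forall j : 'I_m, B j h = 0].

Definition direct_sum (R : realType) (V V0 V1 : set (R -> R)) : Prop :=
  (forall h, V h ->
     exists u v, [/\ V0 u, V1 v & eq01 h (fun s => u s + v s)]) /\
  (forall h, V0 h -> V1 h -> eq01 h (fun=> 0)).

Definition ip1 (R : realType) (m : nat) (a : 'I_m -> R -> R) (u v : R -> R)
    : R :=
  (\int[@lebesgue_measure R]_(s in I01) (diffop a u s * diffop a v s))%R.

Definition ipnorm (R : realType) (ip : (R -> R) -> (R -> R) -> R) (u : R -> R)
    : R :=
  Num.sqrt (ip u u).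

(* V, with the inner product ip, is a Hilbert space of functions on [0,1] with
   reproducing kernel K. *)
Record is_rkhs (R : realType) (V : set (R -> R))
    (ip : (R -> R) -> (R -> R) -> R) (K : R -> R -> R) : Prop := IsRKHS {
  rkhs_linear_space : forall (c : R) u v, V u -> V v ->
    V (fun s => c * u s + v s);
  rkhs_ip_sym : forall u v, V u -> V v -> ip u v = ip v u;
  rkhs_ip_linear : forall (c : R) u v w, V u -> V v -> V w ->
    ip (fun s => c * u s + v s) w = c * ip u w + ip v w;
  rkhs_ip_ge0 : forall u, V u -> 0 <= ip u u;
  rkhs_ip_definite : forall u, V u -> ip u u = 0 -> eq01 u (fun=> 0);
  rkhs_complete : forall u : nat -> R -> R, (forall k, V (u k)) ->
    (forall e : R, 0 < e -> exists N : nat, forall p q : nat,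
       (N <= p)%N -> (N <= q)%N -> ipnorm ip (fun s => u p s - u q s) < e) ->
    exists v, V v /\ (fun k => ipnorm ip (fun s => u k s - v s)) @ \oo --> (0 : R);
  rkhs_kernel_in : forall s, I01 s -> V (K s);
  rkhs_reproducing : forall s u, I01 s -> V u -> ip u (K s) = u s
}.

Definition posdefmx (R : realType) (d : nat) (A : 'M[R]_d) : Prop :=
  A^T = A /\ forall v : 'cV[R]_d, v != 0 -> 0 < (v^T *m A *m v) 0 0.

(* A^(-1/2), for A positive definite *)
Definition invsqrtmx (R : realType) (d : nat) (A : 'M[R]_d) : 'M[R]_d :=
  xget 0 [set S : 'M[R]_d | posdefmx S /\ S *m S = invmx A].

Definition gram (R : realType) (U : Type) (k : U -> U -> R) (n : nat)
    (u : 'I_n -> U) : 'M[R]_n :=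
  \matrix_(i, j) k (u i) (u j).

Definition discretize (R : realType) (d : nat) (t : 'I_d -> R) (x : R -> R)
    : 'cV[R]_d :=
  \col_k x (t k).

Definition is_interpolating_spline (R : realType) (V : set (R -> R))
    (ip : (R -> R) -> (R -> R) -> R) (d : nat) (t : 'I_d -> R)
    (x h : R -> R) : Prop :=
  [/\ V h, forall k, h (t k) = x (t k) &
      forall g, V g -> (forall k, g (t k) = x (t k)) ->
        ipnorm ip h <= ipnorm ip g].

Definition Lspline (R : realType) (m : nat) (a : 'I_m -> R -> R)
    (B : 'I_m -> (R -> R) -> R) (d : nat) (t : 'I_d -> R) (x : R -> R)
    : R -> R :=
  xget (fun=> 0) [set h | is_interpolating_spline (H1 B) (ip1 a) t x h].

Definition euclid_norm (R : realType) (d : nat) (u : 'cV[R]_d) : R :=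
  Num.sqrt (\sum_(i < d) u i 0 ^+ 2).

Definition gauss_Rd (R : realType) (gamma : R) (d : nat) (u v : 'cV[R]_d) : R :=
  expR (- gamma * euclid_norm (u - v) ^+ 2).

Definition gauss_L2 (R : realType) (gamma : R) (u v : R -> R) : R :=
  expR (- gamma * L2norm (fun s => u s - v s) ^+ 2).

Definition kernel_comp (R : realType) (d : nat)
    (k : 'cV[R]_d -> 'cV[R]_d -> R) (A : 'M[R]_d) (u v : 'cV[R]_d) : R :=
  k (A *m u) (A *m v).

Definition svm_feasible (R : realType) (n : nat) (y : 'I_n -> R) (C : R)
    : set ('I_n -> R) :=
  [set alpha | \sum_(i < n) alpha i * y i = 0 /\
               forall i, 0 <= alpha i <= C].

Definition svm_objective (R : realType) (n : nat) (G : 'M[R]_n) (y : 'I_n -> R)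
    (alpha : 'I_n -> R) : R :=
  \sum_(i < n) alpha i
  - \sum_(i < n) \sum_(j < n) alpha i * alpha j * y i * y j * G i j.

Record max_problem (R : realType) (A : Type) := MaxProblem {
  feasible : set A;
  objective : A -> R
}.

Definition svm_problem (R : realType) (U : Type) (k : U -> U -> R) (n : nat)
    (u : 'I_n -> U) (y : 'I_n -> R) (C : R) : max_problem R ('I_n -> R) :=
  MaxProblem (svm_feasible y C) (svm_objective (gram k u) y).

Definition hinge_loss (R : realType) (n : nat) (G : 'M[R]_n) (y : 'I_n -> R)
    (alpha : 'I_n -> R) (b : R) : R :=
  \sum_(l < n)
    Num.max 0 (1 - y l * (2 * (\sum_(i < n) alpha i * y i * G i l) + b)).

(* A rule selecting (alpha*, b* ) from the Gram matrix, the labels and C only *)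
Definition svm_rule (R : realType) (n : nat) : Type :=
  'M[R]_n -> ('I_n -> R) -> R -> ('I_n -> R) * R.

Definition svm_rule_correct (R : realType) (n : nat) (rule : svm_rule R n)
    : Prop :=
  forall (G : 'M[R]_n) (y : 'I_n -> R) (C : R),
    0 < C -> (forall i, y i = 1 \/ y i = -1) ->
    [/\ svm_feasible y C (rule G y C).1,
        forall alpha, svm_feasible y C alpha ->
          svm_objective G y alpha <= svm_objective G y (rule G y C).1 &
        forall b, hinge_loss G y (rule G y C).1 (rule G y C).2
                  <= hinge_loss G y (rule G y C).1 b].

Definition sign1 (R : realType) (z : R) : R := if 0 <= z then 1 else -1.

Definition svm_classifier (R : realType) (n : nat) (rule : svm_rule R n)
    (U : Type) (k : U -> U -> R) (u : 'I_n -> U) (y : 'I_n -> R) (C : R)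
    (v : U) : R :=
  let: (alpha, b) := rule (gram k u) y C in
  sign1 (2 * (\sum_(i < n) alpha i * y i * k (u i) v) + b).

Definition phi_x (R : realType) (K : R -> R -> R) (n d : nat)
    (rule : svm_rule R n) (t : 'I_d -> R) (gamma C : R) (x : 'I_n -> R -> R)
    (y : 'I_n -> R) : 'cV[R]_d -> R :=
  svm_classifier rule
    (kernel_comp (gauss_Rd gamma (d := d)) (invsqrtmx (gram K t)))
    (fun i => discretize t (x i)) y C.

Definition phi_h (R : realType) (m : nat) (a : 'I_m -> R -> R)
    (B : 'I_m -> (R -> R) -> R) (n d : nat) (rule : svm_rule R n)
    (t : 'I_d -> R) (gamma C : R) (x : 'I_n -> R -> R) (y : 'I_n -> R)
    (z : R -> R) : R :=
  svm_classifier rule (gauss_L2 gamma)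
    (fun i => diffop a (Lspline a B t (x i))) y C
    (diffop a (Lspline a B t z)).

(* Main.v *)
(* Both SVMs depend on their inputs only through the Gram matrices, so it is
   enough that the two kernels agree.  The spline h interpolating x has the same
   inner products in H_1 as sum_i c_i K(t_i, .) with c = K_d^-1 x, so the
   reproducing property gives <h, h'>_1 = x^T K_d^-1 x' for splines h, h', hence
   |Lh - Lh'|^2 = (x - x')^T K_d^-1 (x - x') = |K_d^(-1/2) (x - x')|^2.
   The existence of K_d^(-1/2) comes from the complex spectral theorem: the
   eigenvalues are real and positive, and a real polynomial in the matrix that
   interpolates a root function at them is again a real matrix. *)
Require Import Defs.
From HB Require Import structures.
From mathcomp Require Import all_boot all_order all_algebra.
From mathcomp Require Import all_classical all_reals all_analysis.
From mathcomp Require Import spectral complex ring lra.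
Import Order.TTheory GRing.Theory Num.Theory.
Import numFieldNormedType.Exports.
Local Open Scope classical_set_scope.
Local Open Scope ring_scope.
Set Implicit Arguments.
Unset Strict Implicit.

(** * Inverse square roots of positive definite matrices *)

Lemma interpolating_poly (F : fieldType) (s : seq F) (f : F -> F) :
  exists p : {poly F}, {in s, forall z, p.[z] = f z}.
Proof.
elim: s => [|z s [p ps]]; first by exists 0.
have [zs|zs] := boolP (z \in s).
  by exists p => w; rewrite inE => /orP[/eqP->|]; exact: ps.
(* Newton's scheme: [q] vanishes at the earlier nodes, so adding a multiple of it corrects the value
   at [z] only. *)
pose q := \prod_(w <- s) ('X - w%:P).
have qz : q.[z] != 0 by rewrite -/(root q z) root_prod_XsubC.
exists (p + ((f z - p.[z]) / q.[z])%:P * q) => w.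
rewrite hornerD hornerCM inE => /predU1P[->|ws].
  by rewrite divfK// addrC subrK.
have /rootP -> : root q w by rewrite root_prod_XsubC.
by rewrite mulr0 addr0 ps.
Qed.

Lemma trmx_mulmx_sum_sqr (R : numDomainType) (d : nat) (v : 'cV[R]_d) :
  (v^T *m v) 0 0 = \sum_(i < d) v i 0 ^+ 2.
Proof. by rewrite mxE; apply: eq_bigr => i _; rewrite mxE expr2. Qed.

Lemma trmx_mulmx_gt0 (R : realDomainType) (d : nat) (v : 'cV[R]_d) :
  v != 0 -> 0 < (v^T *m v) 0 0.
Proof.
move=> v0; rewrite trmx_mulmx_sum_sqr lt0r sumr_ge0 ?andbT; last first.
  by move=> i _; exact: sqr_ge0.
apply: contra v0; rewrite psumr_eq0; last by move=> i _; exact: sqr_ge0.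
move=> /allP v0; apply/eqP/colP => i; rewrite mxE; apply/eqP.
by rewrite -sqrf_eq0; exact: (v0 i (mem_index_enum _)).
Qed.

Lemma posdefmx_unit (R : realType) (d : nat) (A : 'M[R]_d) :
  posdefmx A -> A \in unitmx.
Proof.
move=> [AT Apos]; rewrite -unitmx_tr -row_free_unit -kermx_eq0.
apply/eqP/row_matrixP => i; rewrite row0; set v := row i _.
have vA : v *m A^T = 0 by rewrite -row_mul mulmx_ker row0.
apply/eqP/negPn/negP => v0.
have := Apos v^T; rewrite trmx_eq0 => /(_ v0).
by rewrite trmxK -{1}AT vA mul0mx mxE ltxx.
Qed.

Lemma posdefmx_inv (R : realType) (d : nat) (A : 'M[R]_d) :
  posdefmx A -> posdefmx (invmx A).
Proof.
move=> Apd; have Au := posdefmx_unit Apd; case: Apd => AT Apos.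
split=> [|v v0]; first by rewrite trmx_inv AT.
have w0 : invmx A *m v != 0.
  apply: contra v0 => /eqP /(congr1 (mulmx A)).
  by rewrite mulKVmx// mulmx0 => ->.
by have := Apos _ w0; rewrite trmx_mul trmx_inv AT -!mulmxA mulKVmx.
Qed.

Lemma posdefmx_eigenvalue_gt0 (R : realType) (d : nat) (A : 'M[R]_d) (l : R) :
  posdefmx A -> eigenvalue A l -> 0 < l.
Proof.
move=> [_ Apos] /eigenvalueP[v vA v0].
have vT0 : v^T != 0 by rewrite trmx_eq0.
have := Apos _ vT0; rewrite trmxK vA -scalemxAl mxE pmulr_lgt0//.
by have := trmx_mulmx_gt0 vT0; rewrite trmxK.
Qed.

(** A real symmetric matrix is Hermitian over the complex numbers, hence unitarily diagonalizable
    with real spectrum. That each [l 0 i] is an eigenvalue of the real matrix [A] lets positive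
    definiteness of [A] bear on it. *)
Lemma symmetric_spectral (R : rcfType) (d : nat) (A : 'M[R]_d) : A^T = A ->
  exists (P : 'M[R[i]]_d) (l : 'rV[R]_d),
    [/\ P \in unitmx,
        map_mx (real_complex R) A
          = invmx P *m diag_mx (map_mx (real_complex R) l) *m P &
        forall i, eigenvalue A (l 0 i)].
Proof.
move=> AT; set AC := map_mx _ A.
have ACherm : AC \is hermsymmx.
  apply: realsym_hermsym.
    by apply/is_hermitianmxP; rewrite expr0 scale1r map_mx_id// map_trmx AT.
  by apply/mxOverP => i j; rewrite mxE; apply/complex_realP; exists (A i j).
have /hermitian_normalmx/orthomx_spectralP ACE := ACherm.
have Pu := spectral_unit AC.
have /mxOverP lreal := hermitian_spectral_diag_real ACherm.
set P := spectralmx AC in ACE Pu; set D := spectral_diag AC in ACE lreal.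
have DE : D = map_mx (real_complex R) (map_mx (@complex.Re R) D).
  by apply/rowP => i; rewrite !mxE RRe_real.
exists P, (map_mx (@complex.Re R) D); split; [exact: Pu | by rewrite -DE |].
move=> i; rewrite eigenvalue_root_char.
(* Being a root of the characteristic polynomial can be tested over the complex numbers, where row
   [i] of [P] is an eigenvector. *)
rewrite -(fmorph_root (real_complex R)) map_char_poly -eigenvalue_root_char.
apply/eigenvalueP; exists (row i P).
  rewrite -[map_mx _ A]/AC -row_mul ACE -!mulmxA mulKVmx// row_mul.
  rewrite row_diag_mx -scalemxAl -rowE.
  by rewrite mxE; congr (_ *: _); exact/esym/RRe_real.
apply: contraTneq Pu => Pi0; rewrite -row_free_unit.
apply/negP => /row_freeP[Q PQ].
have := congr1 (row i) PQ; rewrite row_mul Pi0 mul0mx row1 => /rowP/(_ i).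
by rewrite !mxE !eqxx => /esym/eqP; rewrite oner_eq0.
Qed.

(* The root is a polynomial in [A] interpolating the fourth root at the
   eigenvalues; a fourth root [T] is what makes the square root [T *m T] of [A]
   positive definite, as its quadratic form is the squared norm of [T *m v]. *)
Lemma posdefmx_root (R : realType) (d : nat) (A : 'M[R]_d) :
  posdefmx A -> exists T : 'M[R]_d, T^T = T /\ T *m T *m (T *m T) = A.
Proof.
case: d A => [|d] A Apd.
  by exists A; split; [case: Apd | rewrite [RHS]flatmx0 flatmx0].
have [P [l [Pu AE Al]]] := symmetric_spectral (proj1 Apd).
have [p pl] := interpolating_poly [seq l 0 i | i : 'I_d.+1]
  (fun z => Num.sqrt (Num.sqrt z)).
exists (horner_mx A p); split.
  case: Apd => AT _.
  (* Transposition is linear and fixes every power of [A], hence every polynomial in [A]. *)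
  rewrite -[p]coefK poly_def !raddf_sum/=; apply: eq_bigr => i _.
  rewrite !linearZ/= rmorphXn/= horner_mx_X; congr (_ *: _).
  elim: (i : nat) => [|k IH]; first by rewrite trmx1.
  by rewrite [in LHS]exprS trmx_mul IH AT exprSr.
set pA := horner_mx A p; rewrite -[LHS]/(pA * pA * (pA * pA)) /pA.
rewrite -!rmorphM/=; set q := p * p * (p * p).
(* The polynomial [q], the fourth power of [p], fixes each eigenvalue; nonnegativity of the
   eigenvalues is what lets the nested square roots cancel. *)
have ql : map_mx (horner (map_poly (real_complex R) q))
    (map_mx (real_complex R) l) = map_mx (real_complex R) l.
  apply/rowP => i; rewrite 2!mxE horner_map; congr (_%:C)%C.
  have l0 := ltW (posdefmx_eigenvalue_gt0 Apd (Al i)).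
  rewrite !hornerM pl; last by rewrite map_f// mem_enum.
  by rewrite -!expr2 sqr_sqrtr ?sqrtr_ge0// sqr_sqrtr.
apply: (@map_mx_inj _ _ (real_complex R)).
rewrite map_horner_mx AE (horner_mx_uconjC _ _ Pu) horner_mx_diag.
by rewrite ql.
Qed.

(** [invsqrtmx] is a choice that falls back on 0, so a witness is due: [T *m T], for a symmetric
    fourth root [T] of [invmx A]. *)
Lemma posdefmx_invsqrtmx (R : realType) (d : nat) (A : 'M[R]_d) :
  posdefmx A ->
  posdefmx (invsqrtmx A) /\ invsqrtmx A *m invsqrtmx A = invmx A.
Proof.
move=> /posdefmx_inv Apd.
suff : exists S, [set S : 'M[R]_d | posdefmx S /\ S *m S = invmx A] S.
  by move=> [S SP]; rewrite /invsqrtmx; case: xgetP => [_ -> //|/(_ S)].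
have [T [TT TE]] := posdefmx_root Apd.
exists (T *m T); split=> //; split=> [|v v0]; first by rewrite trmx_mul TT.
have Tv0 : T *m v != 0.
  apply: contra v0 => /eqP Tv; have := posdefmx_unit Apd.
  rewrite -TE -!mulmxA => Tu; apply/eqP.
  by rewrite -[v](mulKmx Tu) -!mulmxA Tv !mulmx0.
by have := trmx_mulmx_gt0 Tv0; rewrite trmx_mul TT !mulmxA.
Qed.

(** * Square integrable functions on the unit interval *)

Lemma measurable_I01 (R : realType) : @measurable _ (measurableTypeR R) I01.
Proof. exact: measurable_itv. Qed.

(** Hölder's inequality, applied to the extensions by 0. *)
Lemma L2_01_integrable_mul (R : realType) (f g : R -> R) :
  L2_01 f -> L2_01 g ->
  (@lebesgue_measure R).-integrable I01 (EFin \o (fun s => f s * g s)).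
Proof.
move=> f2 g2; have /Lfun1_integrable fg := Lfun2_mul_Lfun1 f2 g2.
rewrite integrable_mkcond; last exact: measurable_I01.
rewrite [X in _.-integrable _ X]
  (_ : _ = EFin \o ((f \_ I01) \* (g \_ I01)))//.
apply/funext => s /=; rewrite /patch.
by case: ifP => //= _; rewrite mulr0.
Qed.

(** An infinite integral is covered too: [fine] then sends both sides to 0. *)
Lemma L2norm_sqr (R : realType) (f : R -> R) :
  L2norm f ^+ 2 = (\int[@lebesgue_measure R]_(s in I01) (f s * f s))%R.
Proof.
rewrite /L2norm -powR_mulrn ?fine_ge0 ?Lnorm_ge0// -fine_poweR.
rewrite poweR_Lnorm ?pnatr_eq0//.
rewrite Rintegral_mkcond /Rintegral; congr fine; apply: eq_integral => s _ /=.
rewrite powR_mulrn ?normr_ge0// real_normK ?num_real// /patch.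
by case: ifP => _; rewrite ?expr2// mulr0.
Qed.

Lemma L2norm_sub_sqr (R : realType) (f g : R -> R) : L2_01 f -> L2_01 g ->
  L2norm (fun s => f s - g s) ^+ 2 =
  (\int[@lebesgue_measure R]_(s in I01) (f s * f s)
   - 2 * \int[@lebesgue_measure R]_(s in I01) (f s * g s)
   + \int[@lebesgue_measure R]_(s in I01) (g s * g s))%R.
Proof.
move=> f2 g2; have mI := @measurable_I01 R.
have ff := L2_01_integrable_mul f2 f2.
have fg := L2_01_integrable_mul f2 g2.
have gg := L2_01_integrable_mul g2 g2.
have fg' : (@lebesgue_measure R).-integrable I01
    (EFin \o (fun s => 2 * (f s * g s))).
  exact: (integrableZl mI 2 fg).
have ffg : (@lebesgue_measure R).-integrable I01
    (EFin \o (fun s => f s * f s - 2 * (f s * g s))).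
  exact: (integrableB mI ff fg').
rewrite L2norm_sqr -RintegralZl// -RintegralB// -RintegralD//.
by apply: eq_Rintegral => s _; ring.
Qed.

(** * Minimal norm interpolation in a reproducing kernel Hilbert space *)

Section Rkhs.
Variables (R : realType) (V : set (R -> R)) (ip : (R -> R) -> (R -> R) -> R).
Variable K : R -> R -> R.
Hypothesis rkhsV : is_rkhs V ip K.

Let Vlin (c : R) u v (Vu : V u) (Vv : V v) := rkhs_linear_space rkhsV c Vu Vv.

Lemma rkhs_zero : V (fun=> 0).
Proof.
(* Closure under [c * u + v] yields the zero function only from some element of [V]; [K 0] is
   one. *)
have V0 : V (K 0).
  by apply: (rkhs_kernel_in rkhsV); rewrite /I01/= in_itv/= lexx ler01.
have := Vlin (-1) V0 V0.
by rewrite (_ : (fun s => _) = (fun=> 0))//; apply/funext => s; ring.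
Qed.

Lemma rkhs_ip_zero w : V w -> ip (fun=> 0) w = 0.
Proof.
move=> Vw; have := rkhs_ip_linear rkhsV 1 rkhs_zero rkhs_zero Vw.
rewrite (_ : (fun s => _) = (fun=> 0)); last by apply/funext => s; ring.
by move=> h; lra.
Qed.

Lemma rkhs_sum (I : Type) (r : seq I) (c : I -> R) (e : I -> R -> R) :
  (forall i, V (e i)) -> V (fun s => \sum_(i <- r) c i * e i s).
Proof.
move=> Ve; elim: r => [|i r IH].
  by under eq_fun do rewrite big_nil; exact: rkhs_zero.
by under eq_fun do rewrite big_cons; exact: Vlin.
Qed.

Lemma rkhs_ip_sum (I : Type) (r : seq I) (c : I -> R) (e : I -> R -> R) w :
  (forall i, V (e i)) -> V w ->
  ip (fun s => \sum_(i <- r) c i * e i s) w = \sum_(i <- r) c i * ip (e i) w.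
Proof.
move=> Ve Vw; elim: r => [|i r IH].
  by under eq_fun do rewrite big_nil; rewrite big_nil rkhs_ip_zero.
under eq_fun do rewrite big_cons.
by rewrite (rkhs_ip_linear rkhsV) ?IH ?big_cons//; exact: rkhs_sum.
Qed.

(** Degenerate case of Cauchy-Schwarz. It stands in for [r = 0], since definiteness makes [r] vanish
    on [0,1] only. *)
Lemma rkhs_ip_null r w : V r -> V w -> ip r r = 0 -> ip r w = 0.
Proof.
move=> Vr Vw rr; apply/eqP/negPn/negP => rw.
(* for this [c], [ip (c r + w) (c r + w) = 2 c (ip r w) + ip w w = -1] *)
pose c := - (ip w w + 1) / (2 * ip r w).
have Vc := Vlin c Vr Vw.
have := rkhs_ip_ge0 rkhsV Vc.
rewrite (rkhs_ip_linear rkhsV)// (rkhs_ip_sym rkhsV Vr Vc).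
rewrite (rkhs_ip_sym rkhsV Vw Vc) !(rkhs_ip_linear rkhsV)//.
rewrite rr (rkhs_ip_sym rkhsV Vw Vr) mulr0 add0r addrA -mulrDl.
suff -> : (c + c) * ip r w = - (ip w w + 1) by lra.
by rewrite /c; field.
Qed.

Variables (d : nat) (t : 'I_d -> R).
Hypothesis t01 : forall k, I01 (t k).
Hypothesis Kd_posdef : posdefmx (gram K t).

Let Kt k : V (K (t k)) := rkhs_kernel_in rkhsV (t01 k).

Definition kernel_interpolant (z : R -> R) : R -> R :=
  fun s => \sum_(i < d) (invmx (gram K t) *m discretize t z) i 0 * K (t i) s.

Lemma kernel_interpolant_in z : V (kernel_interpolant z).
Proof. exact: rkhs_sum. Qed.

Lemma kernel_interpolantE z k : kernel_interpolant z (t k) = z (t k).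
Proof.
have Ku : gram K t \in unitmx by exact: posdefmx_unit.
have /colP/(_ k) := mulKVmx Ku (discretize t z).
rewrite [RHS]mxE => <-; rewrite mxE; apply: eq_bigr => i _.
suff -> : K (t i) (t k) = gram K t k i by exact: mulrC.
by rewrite -[in RHS](proj1 Kd_posdef) !mxE.
Qed.

(** Pairing with [K (t i)] evaluates [w] at [t i], so only the values of [w] at the nodes enter. *)
Lemma ip_kernel_interpolant z w : V w ->
  ip (kernel_interpolant z) w =
  ((discretize t z)^T *m invmx (gram K t) *m discretize t w) 0 0.
Proof.
move=> Vw; rewrite rkhs_ip_sum//.
have -> : (discretize t z)^T *m invmx (gram K t)
    = (invmx (gram K t) *m discretize t z)^T.
  by rewrite trmx_mul trmx_inv (proj1 Kd_posdef).
rewrite mxE; apply: eq_bigr => i _.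
rewrite (rkhs_ip_sym rkhsV)// (rkhs_reproducing rkhsV)//.
by congr (_ * _); rewrite [RHS]mxE.
Qed.

(* Pythagoras: [g - kernel_interpolant z] vanishes at the nodes, hence is
   orthogonal to every [K (t k)]. *)
Lemma ip_sub_kernel_interpolant z g :
  V g -> (forall k, g (t k) = z (t k)) ->
  ip (fun s => -1 * kernel_interpolant z s + g s)
     (fun s => -1 * kernel_interpolant z s + g s) =
  ip g g - ip (kernel_interpolant z) (kernel_interpolant z).
Proof.
move=> Vg gz; have Vs := kernel_interpolant_in z.
have Vr := Vlin (-1) Vs Vg.
have sg : ip (kernel_interpolant z) g
    = ip (kernel_interpolant z) (kernel_interpolant z).
  rewrite !ip_kernel_interpolant//; congr ((_ *m _) _ _).
  by apply/colP => k; rewrite !mxE gz kernel_interpolantE.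
rewrite (rkhs_ip_linear rkhsV)// (rkhs_ip_sym rkhsV Vs Vr).
rewrite (rkhs_ip_sym rkhsV Vg Vr) !(rkhs_ip_linear rkhsV)//.
by rewrite (rkhs_ip_sym rkhsV Vg Vs) sg; ring.
Qed.

Lemma kernel_interpolant_spline z :
  is_interpolating_spline V ip t z (kernel_interpolant z).
Proof.
have Vs := kernel_interpolant_in z.
split=> // [k|g Vg gz]; first exact: kernel_interpolantE.
rewrite /ipnorm; apply: ler_wsqrtr; rewrite -subr_ge0.
rewrite -ip_sub_kernel_interpolant//.
exact: (rkhs_ip_ge0 rkhsV (Vlin _ Vs Vg)).
Qed.

(** By Pythagoras and minimality of [h], the difference of [h] and the interpolant has norm zero, so
    it is orthogonal to [V]. Inner products are compared because two minimizers may differ outside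
    [0,1]. *)
Lemma spline_ip_kernel_interpolant z h w :
  is_interpolating_spline V ip t z h -> V w ->
  ip h w = ip (kernel_interpolant z) w.
Proof.
move=> [Vh hz hmin] Vw; have Vs := kernel_interpolant_in z.
have Vr := Vlin (-1) Vs Vh.
have rr : ip (fun s => -1 * kernel_interpolant z s + h s)
             (fun s => -1 * kernel_interpolant z s + h s) = 0.
  apply/le_anti; rewrite (rkhs_ip_ge0 rkhsV)// andbT.
  rewrite ip_sub_kernel_interpolant// subr_le0.
  have := hmin _ Vs (kernel_interpolantE z).
  by rewrite /ipnorm ler_sqrt ?(rkhs_ip_ge0 rkhsV).
have := rkhs_ip_null Vr Vw rr.
by rewrite (rkhs_ip_linear rkhsV)//; lra.
Qed.

Lemma ip_splines z1 z2 h1 h2 :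
  is_interpolating_spline V ip t z1 h1 -> is_interpolating_spline V ip t z2 h2 ->
  ip h1 h2 = ((discretize t z1)^T *m invmx (gram K t) *m discretize t z2) 0 0.
Proof.
move=> spl1 spl2; have [Vh2 h2z _] := spl2.
rewrite (spline_ip_kernel_interpolant spl1)// ip_kernel_interpolant//.
by congr ((_ *m _) _ _); apply/colP => k; rewrite !mxE h2z.
Qed.

End Rkhs.

(** * Agreement of the two kernels and of the classifiers *)

Lemma euclid_norm_mulmx_sqr (R : realType) (d : nat) (S : 'M[R]_d)
    (u : 'cV[R]_d) :
  euclid_norm (S *m u) ^+ 2 = (u^T *m (S^T *m S) *m u) 0 0.
Proof.
rewrite /euclid_norm sqr_sqrtr; last by apply: sumr_ge0 => i _; exact: sqr_ge0.
by rewrite -trmx_mulmx_sum_sqr trmx_mul !mulmxA.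
Qed.

Unset Implicit Arguments.

Theorem theorem2 (R : realType) (m : nat) (a : 'I_m -> R -> R)
    (B : 'I_m -> (R -> R) -> R) (K : R -> R -> R)
    (d n : nat) (t : 'I_d -> R) (gamma C : R)
    (x : 'I_n -> R -> R) (y : 'I_n -> R) (rule : svm_rule R n)
    (m_ge1 : (1 <= m)%N)
    (L_into_L2 : forall h, sobolev m h -> L2_01 (diffop a h))
    (dim_kerL : has_dim (kerL a) m)
    (B_boundary : forall j, linear_boundary_form m (B j))
    (sobolev_sum : direct_sum (sobolev m) (kerL a) (H1 B))
    (rkhs_H1 : is_rkhs (H1 B) (ip1 a) K)
    (t01 : forall k, I01 (t k))
    (Kd_posdef : posdefmx (gram K t))
    (gamma_gt0 : 0 < gamma) (C_gt0 : 0 < C)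
    (x_in_H1 : forall i, H1 B (x i))
    (y_label : forall i, y i = 1 \/ y i = -1)
    (rule_correct : svm_rule_correct rule) :
  let P_h := svm_problem (gauss_L2 gamma)
               (fun i => diffop a (Lspline a B t (x i))) y C in
  let P_x := svm_problem
               (kernel_comp (gauss_Rd gamma (d := d)) (invsqrtmx (gram K t)))
               (fun i => discretize t (x i)) y C in
  [/\ feasible P_h = feasible P_x,
      forall alpha, objective P_h alpha = objective P_x alpha &
      forall z, H1 B z ->
        phi_h a B rule t gamma C x y z =
        phi_x K rule t gamma C x y (discretize t z)].
Proof.
have [[ST _] SS] := posdefmx_invsqrtmx Kd_posdef.
have KT : (invmx (gram K t))^T = invmx (gram K t) by rewrite -SS trmx_mul ST.
(* [Lspline] is a choice with the zero function as default; the kernel interpolant shows that a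
   spline exists. *)
have splineP z : is_interpolating_spline (H1 B) (ip1 a) t z (Lspline a B t z).
  rewrite /Lspline; case: xgetP => [_ -> //|/(_ (kernel_interpolant K t z))[]].
  exact: kernel_interpolant_spline.
have kernelE z1 z2 :
    gauss_L2 gamma (diffop a (Lspline a B t z1)) (diffop a (Lspline a B t z2)) =
    kernel_comp (gauss_Rd gamma (d := d)) (invsqrtmx (gram K t))
      (discretize t z1) (discretize t z2).
  (* Expanding the square leaves only values of [ip1], so pointwise linearity of
     [diffop], which can fail because of the choice in [weak_D], is not used. *)
  have [[V1 _] _ _] := splineP z1; have [[V2 _] _ _] := splineP z2.
  rewrite /gauss_L2 /kernel_comp /gauss_Rd; congr (expR (_ * _)).
  rewrite L2norm_sub_sqr; [|exact: L_into_L2 ..].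
  rewrite -!/(ip1 a _ _).
  rewrite !(ip_splines rkhs_H1 t01 Kd_posdef (splineP _) (splineP _)).
  rewrite -mulmxBr euclid_norm_mulmx_sqr ST SS.
  set u := discretize t z1; set v := discretize t z2; set Q := invmx _ in KT *.
  (* The cross terms agree because a 1 by 1 matrix is its own transpose and [Q] is symmetric. *)
  have uv : (v^T *m Q *m u) 0 0 = (u^T *m Q *m v) 0 0.
    transitivity ((u^T *m Q *m v)^T 0 0); last by rewrite mxE.
    by rewrite !trmx_mul trmxK KT mulmxA.
  have subE (M N : 'M[R]_1) : (M - N) 0 0 = M 0 0 - N 0 0 by rewrite !mxE.
  rewrite [(u - v)^T]linearB/= !mulmxBl !mulmxBr !subE uv.
  ring.
have gramE : gram (gauss_L2 gamma) (fun i => diffop a (Lspline a B t (x i))) =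
    gram (kernel_comp (gauss_Rd gamma (d := d)) (invsqrtmx (gram K t)))
      (fun i => discretize t (x i)).
  by apply/matrixP => i j; rewrite !mxE kernelE.
split=> // [alpha|z _]; first by rewrite /= gramE.
(* With equal Gram matrices the rule returns the same pair [(alpha, b)]; what remains are the kernel
   values at the new point. *)
rewrite /phi_h /phi_x /svm_classifier gramE; case: (rule _ _ _) => alpha b.
by under eq_bigr do rewrite kernelE.
Qed.
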